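(* Let $M$ be a smooth, connected, orientable $n$-dimensional manifold ($n\ge 2$) and $X$ a smooth vector field on $M$ such that $(M,X)$ is B-integrable (with $k=2$, i.e. with two-dimensional fibers). Then there exists a volume form $\mu$ on $M$ for which $(M,\mu,X)$ is EJ-integrable.
   Context: All objects are smooth; $\mathcal{L}_X$ denotes the Lie derivative along $X$; $\mathbb{R}^0$ is a point. B-integrable (with $k=2$): $(M,X)$ is B-integrable if there is a surjective submersion $F=(f_1,\dots,f_{n-2}):M\to\mathbb{R}^{n-2}$ with compact and connected fibers such that $\mathcal{L}_Xf_\alpha=0$ for all $\alpha=1,\dots,n-2$, and there are two everywhere linearly independent smooth vector fields $Y_1,Y_2$ on $M$ such that $[Y_i,X]=0$ for $i=1,2$, $[Y_i,Y_j]=0$ for $i,j=1,2$, and $\mathcal{L}_{Y_i}f_\alpha=0$ for all $i=1,2$ and $\alpha=1,\dots,n-2$. EJ-integrable (integrable in the sense of Euler–Jacobi): $(M,\mu,X)$, with $\mu\in\Omega^n(M)$ a volume form on the $n$-dimensional manifold $M$, is EJ-integrable if $X$ is a never-vanishing smooth vector field, there is a surjective submersion $F=(f_1,\dots,f_{n-2}):M\to\mathbb{R}^{n-2}$ with compact and connected fibers such that $\mathcal{L}_Xf_\alpha=0$ for all $\alpha=1,\dots,n-2$, and $\mu$ is invariant with respect to $X$, i.e. $\mathcal{L}_X\mu=0$.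
   Formalization: The vector field X is additionally assumed to vanish nowhere: EJ-integrability requires this but B-integrability as defined does not imply it (e.g. X = 0 on the 2-torus is B-integrable). *)

(* Defs.v *)
From HB Require Import structures.
From mathcomp Require Import all_boot all_order all_algebra.
From mathcomp Require Import all_classical all_reals all_analysis.
Import Order.TTheory GRing.Theory Num.Theory.
Import numFieldNormedType.Exports.

Set Implicit Arguments.
Unset Strict Implicit.
Unset Printing Implicit Defensive.

Local Open Scope classical_set_scope.
Local Open Scope ring_scope.

Section Smooth.
Context {R : realType}.

(* Meant for open [U]. On a finite-dimensional source, the derivative is C^k as
   a map into linear maps iff each [fun x => 'd f x v] is C^k. *)
Fixpoint Ck_on (k : nat) n (W : normedModType R)
    (U : set 'rV[R]_n) (f : 'rV[R]_n -> W) : Prop :=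
  match k with
  | 0%N => forall x, U x -> {for x, continuous f}
  | k'.+1 => (forall x, U x -> differentiable f x) /\
             (forall v, Ck_on k' U (fun x => 'd f x v))
  end.

Definition smooth_on n (W : normedModType R)
    (U : set 'rV[R]_n) (f : 'rV[R]_n -> W) : Prop :=
  forall k, Ck_on k U f.

End Smooth.

Section Atlas.
Context {R : realType} {n : nat} {M : topologicalType}.

(* [chart i] restricts to a homeomorphism from the open set [dom i] onto an open
   set of R^n, with inverse [pchart i]; both are extended arbitrarily to total
   functions. *)
Record atlas := Atlas {
  idx : Type;
  dom : idx -> set M;
  chart : idx -> M -> 'rV[R]_n;
  pchart : idx -> 'rV[R]_n -> M;
  dom_open : forall i, open (dom i);
  dom_cover : forall p, exists i, dom i p;
  cod_open : forall i, open (chart i @` dom i);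
  chartK : forall i p, dom i p -> pchart i (chart i p) = p;
  chart_continuous : forall i p, dom i p -> {for p, continuous (chart i)};
  pchart_continuous : forall i x,
    (chart i @` dom i) x -> {for x, continuous (pchart i)}
}.

Definition overlap (A B : atlas) (i : idx A) (j : idx B) : set 'rV[R]_n :=
  chart i @` (dom i `&` dom j).

Definition transition (A B : atlas) (i : idx A) (j : idx B) :
    'rV[R]_n -> 'rV[R]_n :=
  chart j \o pchart i.

Definition compatible (A B : atlas) : Prop :=
  forall (i : idx A) (j : idx B),
    smooth_on (overlap i j) (transition i j) /\
    smooth_on (overlap j i) (transition j i).

Definition oriented (A : atlas) : Prop :=
  forall (i j : idx A) x, overlap i j x ->
    0 < \det (jacobian (transition i j) x).

End Atlas.
Arguments atlas : clear implicits.

Record manifold (R : realType) (n : nat) := Manifold {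
  carrier :> topologicalType;
  manifold_hausdorff : hausdorff_space carrier;
  manifold_second_countable : @second_countable carrier;
  matlas : atlas R n carrier;
  matlas_smooth : compatible matlas matlas
}.

Section Manifold.
Context {R : realType} {n : nat} (M : manifold R n).

Notation I := (idx (matlas M)).

Definition cod (i : I) : set 'rV[R]_n := chart i @` dom i.

Definition orientable : Prop :=
  exists A : atlas R n M, compatible A (matlas M) /\ compatible A A /\ oriented A.

Definition smooth_map (W : normedModType R) (f : M -> W) : Prop :=
  forall i : I, smooth_on (cod i) (f \o pchart i).

Definition submersion m (F : M -> 'rV[R]_m) : Prop :=
  forall (i : I) x, cod i x -> range ('d (F \o pchart i) x) = setT.

(* [X i x] is the coordinate vector, in the chart [i], of the value of [X] at the
   point of coordinates [x]; it is meaningful only for [x] in [cod i]. *)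
Record vector_field := VectorField {
  vf :> I -> 'rV[R]_n -> 'rV[R]_n;
  vf_smooth : forall i, smooth_on (cod i) (vf i);
  vf_compat : forall (i j : I) x, overlap i j x ->
    vf j (transition i j x) = 'd (transition i j) x (vf i x)
}.

Definition map_rows k (f : 'rV[R]_n -> 'rV[R]_n) (V : 'M[R]_(k, n)) :
    'M[R]_(k, n) :=
  \matrix_(l < k) f (row l V).

Definition set_row k (l : 'I_k) (u : 'rV[R]_n) (V : 'M[R]_(k, n)) :
    'M[R]_(k, n) :=
  \matrix_(l' < k) (if l' == l then u else row l' V).

Definition multilinear k (w : 'M[R]_(k, n) -> R) : Prop :=
  forall (l : 'I_k) V (a : R) u v,
    w (set_row l (a *: u + v) V) = a * w (set_row l u V) + w (set_row l v V).

Definition alternating k (w : 'M[R]_(k, n) -> R) : Prop :=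
  forall V (l l' : 'I_k), l != l' -> row l V = row l' V -> w V = 0.

(* Differential k-forms: [w i x V] is the value at the point of coordinates [x]
   in the chart [i] on the [k] tangent vectors given by the rows of [V]. *)
Record diff_form (k : nat) := Form {
  form_val :> I -> 'rV[R]_n -> 'M[R]_(k, n) -> R;
  form_multilinear : forall i x, cod i x -> multilinear (form_val i x);
  form_alternating : forall i x, cod i x -> alternating (form_val i x);
  form_smooth : forall i V, smooth_on (cod i) (fun x => form_val i x V : R^o);
  form_compat : forall (i j : I) x V, overlap i j x ->
    form_val j (transition i j x) (map_rows ('d (transition i j) x) V) =
    form_val i x V
}.

Definition volume_form (mu : diff_form n) : Prop :=
  forall (i : I) x, cod i x -> exists V, mu i x V != 0.

(* Coordinate expressions in the chart [i], like [bracket] and [lie_form]: all three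
   obey the transformation law, so vanishing may be tested chart by chart. *)
Definition lie_fun (X : vector_field) (f : M -> R) (i : I) (x : 'rV[R]_n) : R :=
  'd ((f : M -> R^o) \o pchart i) x (X i x).

Definition bracket (X Y : vector_field) (i : I) (x : 'rV[R]_n) : 'rV[R]_n :=
  'd (Y i) x (X i x) - 'd (X i) x (Y i x).

(* From (L_X w)(V_1, .., V_k) = X (w (V_1, .., V_k))
   - \sum_l w (V_1, .., [X, V_l], .., V_k), with each V_l extended to a field that
   is constant in the chart, so that [X, V_l] = - 'd X V_l. *)
Definition lie_form k (X : vector_field) (w : diff_form k)
    (i : I) (x : 'rV[R]_n) (V : 'M[R]_(k, n)) : R :=
  'd (fun y => w i y V : R^o) x (X i x) +
  \sum_(l < k) w i x (set_row l ('d (X i) x (row l V)) V).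

Definition first_integral (X : vector_field) (f : M -> R) : Prop :=
  forall i x, cod i x -> lie_fun X f i x = 0.

Definition commuting (X Y : vector_field) : Prop :=
  forall i x, cod i x -> bracket X Y i x = 0.

Definition invariant_form k (X : vector_field) (w : diff_form k) : Prop :=
  forall i x, cod i x -> forall V, lie_form X w i x V = 0.

Definition never_vanishing (X : vector_field) : Prop :=
  forall i x, cod i x -> X i x != 0.

Definition independent_fields k (Y : 'I_k -> vector_field) : Prop :=
  forall i x, cod i x -> row_free (\matrix_(l < k) Y l i x).

Definition component m (F : M -> 'rV[R]_m) (a : 'I_m) (p : M) : R := F p 0 a.

Definition fibration_by_integrals m (X : vector_field) (F : M -> 'rV[R]_m) :
    Prop :=
  [/\ smooth_map F, range F = setT, submersion F,
      forall c, compact (F @^-1` [set c]) /\ connected (F @^-1` [set c]) &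
      forall a, first_integral X (component F a)].

Definition B_integrable (X : vector_field) : Prop :=
  exists (F : M -> 'rV[R]_(n - 2)) (Y : 'I_2 -> vector_field),
    [/\ fibration_by_integrals X F, independent_fields Y,
        forall l, commuting (Y l) X,
        forall l l', commuting (Y l) (Y l') &
        forall l a, first_integral (Y l) (component F a)].

Definition EJ_integrable (mu : diff_form n) (X : vector_field) : Prop :=
  [/\ volume_form mu, never_vanishing X,
      exists F : M -> 'rV[R]_(n - 2), fibration_by_integrals X F &
      invariant_form X mu].

End Manifold.

(* Main.v *)
(* Near any point the fibers of F are spanned by the commuting fields Y_1, Y_2,
   so there is exactly one form mu with
     mu (Y_1, Y_2, Z_1, .., Z_q) = det (dF Z_1, .., dF Z_q)   for all Z,
   where q = n - 2. It is globally defined, hence no orientation is needed, and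
   it never vanishes. Since X commutes with Y_1, Y_2 and preserves F, its flow
   preserves both sides of this equation, so it preserves mu. In a chart,
   mu = h det, and the invariance becomes X h + h div X = 0, obtained by
   differentiating the equation along X for constant Z. *)
Require Import Defs.
From mathcomp Require Import all_boot all_order all_algebra.
From mathcomp Require Import all_classical all_reals all_analysis.
Import Order.TTheory GRing.Theory Num.Theory.
Import numFieldNormedType.Exports.

Set Implicit Arguments.
Unset Strict Implicit.
Unset Printing Implicit Defensive.

Local Open Scope classical_set_scope.
Local Open Scope ring_scope.

(** * Differentiability classes on open sets *)

Section NearDiff.
Context {R : realType} {V W : normedModType R}.

(** The first-order expansion of [f] at [x] involves only its germ, so it is also an expansion of
    [g]; uniqueness of the differential then identifies ['d g x]. *)
Lemma near_eq_is_diff (f g : V -> W) x :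
  {near x, f =1 g} -> differentiable f x ->
  differentiable g x /\ 'd g x = 'd f x :> (V -> W).
Proof.
move=> fg fx.
have [dfc dfE] : continuous ('d f x) /\
    f \o shift x = cst (f x) + 'd f x +o_ 0 id by apply/diff_locallyP.
have dgE : g \o shift x = cst (g x) + 'd f x +o_ 0 id.
  apply/eqaddoP => _/posnumP[e].
  move/eqaddoP : dfE => /(_ _ [gt0 of e%:num]) H.
  have gs : \forall y \near 0, f (y + x) = g (y + x).
    move: fg; rewrite (near_shift 0 x) subr0; exact.
rewrite -(nbhs_singleton fg).
  by near=> y; rewrite /= !fctE /= -(near gs y)//; near: y; exact: H.
have dg : 'd g x = 'd f x :> (V -> W) by apply: diff_unique.
by split; [apply/diff_locallyP; rewrite dg; split|exact: dg].
Unshelve. all: by end_near. Qed.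

Lemma diff_is_derive (f : V -> W) x v :
  differentiable f x -> is_derive x v f ('d f x v).
Proof. by move=> fx; rewrite -deriveE//; exact/derivableP/diff_derivable. Qed.

End NearDiff.

Section CkOn.
Context {R : realType} {n : nat}.
Implicit Types U : set 'rV[R]_n.

Lemma open_near {T : topologicalType} {P : T -> Prop} (U : set T) x :
  open U -> (forall y, U y -> P y) -> U x -> \forall y \near x, P y.
Proof. by move=> oU UP Ux; apply: (filterS UP); exact: open_nbhs_nbhs. Qed.

(** Openness of [U] turns equality on [U] into equality of germs, which passes to all derivatives.
    This allows replacing a differential by a formula valid only on [U]. *)
Lemma Ck_on_ext k (W : normedModType R) U (f g : 'rV[R]_n -> W) :
  open U -> (forall x, U x -> f x = g x) -> Ck_on k U f -> Ck_on k U g.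
Proof.
move=> oU; elim: k f g => [|k IH] f g fg /=.
  move=> fc x Ux; rewrite /prop_for /continuous_at -(fg x Ux).
  apply: cvg_trans (fc x Ux); apply: (@near_eq_cvg _ _ (nbhs x)).
  exact: (open_near oU fg Ux).
have E x : U x -> differentiable f x ->
    differentiable g x /\ 'd g x = 'd f x :> ('rV_n -> W).
  by move=> Ux; apply: near_eq_is_diff; exact: (open_near oU fg Ux).
move=> [fd fC]; split=> [x Ux|v]; first by have [] := E x Ux (fd x Ux).
apply: (IH _ _ _ (fC v)) => x Ux.
exact: (esym (congr1 (@^~ v) (E x Ux (fd x Ux)).2)).
Qed.

Lemma Ck_onW k (W : normedModType R) U (f : 'rV[R]_n -> W) :
  Ck_on k.+1 U f -> Ck_on k U f.
Proof.
elim: k f => [|k IH] f /=.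
  by move=> [fd _] x Ux; apply: differentiable_continuous; exact: fd.
by move=> [fd fC]; split=> // v; apply: IH; exact: fC.
Qed.

Lemma Ck_on_cst k (W : normedModType R) U (c : W) : Ck_on k U (fun=> c).
Proof.
elim: k c => [|k IH] c /=; first by move=> x _; exact: cst_continuous.
split=> [x _|v]; first exact: differentiable_cst.
rewrite (_ : (fun x => _) = fun=> 0); first exact: IH.
by apply/funext => x; rewrite diff_cst.
Qed.

Lemma Ck_onD k (W : normedModType R) U (f g : 'rV[R]_n -> W) : open U ->
  Ck_on k U f -> Ck_on k U g -> Ck_on k U (fun x => f x + g x).
Proof.
move=> oU; elim: k f g => [|k IH] f g /=.
  by move=> fc gc x Ux; apply: continuousD; [exact: fc|exact: gc].
move=> [fd fC] [gd gC]; split=> [x Ux|v].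
  by apply: differentiableD; [exact: fd|exact: gd].
apply: (Ck_on_ext oU _ (IH _ _ (fC v) (gC v))) => x Ux.
exact: (esym (congr1 (@^~ v) (diffD (fd x Ux) (gd x Ux)))).
Qed.

Lemma Ck_onM k U (f g : 'rV[R]_n -> R^o) : open U ->
  Ck_on k U f -> Ck_on k U g -> Ck_on k U (fun x => f x * g x : R^o).
Proof.
move=> oU; elim: k f g => [|k IH] f g.
  by move=> fc gc x Ux; exact: (@continuousM R _ f g x (fc x Ux) (gc x Ux)).
(* The Leibniz rule brings back [f] and [g] undifferentiated, so their own regularity of order [k]
   is needed next to that of their derivatives. *)
move=> fC gC; have [fC0 gC0] := (Ck_onW fC, Ck_onW gC).
case: fC gC => [fd fC] [gd gC]; split=> [x Ux|v].
  by apply: differentiableM; [exact: fd|exact: gd].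
apply: (Ck_on_ext oU _ (Ck_onD oU (IH _ _ fC0 (gC v)) (IH _ _ gC0 (fC v)))).
move=> x Ux; exact: (esym (congr1 (@^~ v) (diffM (fd x Ux) (gd x Ux)))).
Qed.

Lemma Ck_onV k U (f : 'rV[R]_n -> R^o) : open U ->
  (forall x, U x -> f x != 0) ->
  Ck_on k U f -> Ck_on k U (fun x => (f x)^-1 : R^o).
Proof.
move=> oU f0; elim: k f f0 => [|k IH] f f0.
  by move=> fc x Ux; exact: (@continuousV R _ f x (f0 x Ux) (fc x Ux)).
move=> fC; have fV := IH _ f0 (Ck_onW fC).
case: fC => fd fC; split=> [x Ux|v].
  by apply: differentiableV; [exact: fd|exact: f0].
(* The differential of 1/f is written as the product of -1, 1/f twice and df, so that [Ck_onM]
   applies with the induction hypothesis for 1/f. *)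
have N1 := Ck_on_cst k U (-1 : R^o).
apply: (Ck_on_ext oU _ (Ck_onM oU N1 (Ck_onM oU (Ck_onM oU fV fV) (fC v)))).
move=> x Ux; apply: etrans (esym (congr1 (@^~ v) (diffV (fd x Ux) (f0 x Ux)))).
rewrite /=;
by rewrite -exprVn expr2 mulN1r -mulNr.
Qed.

Lemma diff_mxcoord p q (f : 'rV[R]_n -> 'M[R]_(p, q)) x i j :
  differentiable f x ->
  differentiable (fun y => f y i j : R^o) x /\
  (forall v, 'd (fun y => f y i j : R^o) x v = 'd f x v i j).
Proof.
move=> fx; have dc := differentiable_coord (f x) i j.
have dfij : differentiable (fun y => f y i j : R^o) x.
  exact: (differentiable_comp fx dc).
split=> // v; rewrite -[LHS]deriveE// -deriveE// derive_mx ?mxE//.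
exact: diff_derivable.
Qed.

Lemma Ck_on_mxcoord k p q U (f : 'rV[R]_n -> 'M[R]_(p, q)) i j :
  open U -> Ck_on k U f -> Ck_on k U (fun x => f x i j : R^o).
Proof.
move=> oU; elim: k f => [|k IH] f /=.
  move=> fc x Ux.
  apply: (@continuous_comp _ _ _ f (fun A : 'M[R]_(p, q) => A i j)).
    exact: fc.
  exact: coord_continuous.
move=> [fd fC]; split=> [x Ux|v].
  by have [] := diff_mxcoord i j (fd x Ux).
apply: (Ck_on_ext oU _ (IH _ (fC v))) => x Ux.
by have [_ ->] := diff_mxcoord i j (fd x Ux).
Qed.

Lemma Ck_on_sum k U (I : Type) (r : seq I) (P : pred I)
    (f : I -> 'rV[R]_n -> R^o) : open U -> (forall i, Ck_on k U (f i)) ->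
  Ck_on k U (fun x => \sum_(i <- r | P i) f i x : R^o).
Proof.
move=> oU fC; elim: r => [|i r IH].
  by apply: (Ck_on_ext oU _ (Ck_on_cst _ _ 0)) => x _; rewrite big_nil.
case Pi : (P i); last by apply: (Ck_on_ext oU _ IH) => x _; rewrite big_cons Pi.
by apply: (Ck_on_ext oU _ (Ck_onD oU (fC i) IH)) => x _; rewrite big_cons Pi.
Qed.

Lemma Ck_on_prod k U (I : Type) (r : seq I) (P : pred I)
    (f : I -> 'rV[R]_n -> R^o) : open U -> (forall i, Ck_on k U (f i)) ->
  Ck_on k U (fun x => \prod_(i <- r | P i) f i x : R^o).
Proof.
move=> oU fC; elim: r => [|i r IH].
  by apply: (Ck_on_ext oU _ (Ck_on_cst k U (1 : R^o))) => x _; rewrite big_nil.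
case Pi : (P i); last by apply: (Ck_on_ext oU _ IH) => x _; rewrite big_cons Pi.
by apply: (Ck_on_ext oU _ (Ck_onM oU (fC i) IH)) => x _; rewrite big_cons Pi.
Qed.

Lemma Ck_on_det k p U (A : 'rV[R]_n -> 'M[R]_p) : open U ->
  (forall i j, Ck_on k U (fun x => A x i j : R^o)) ->
  Ck_on k U (fun x => \det (A x) : R^o).
Proof.
move=> oU AC; rewrite /determinant; apply: Ck_on_sum => // s.
by apply: Ck_onM => //; [exact: Ck_on_cst|exact: Ck_on_prod].
Qed.

End CkOn.

(** * Symmetry of second derivatives *)

Section SecondDerivative.
Context {R : realType} {n : nat}.
Implicit Types U : set 'rV[R]_n.

Lemma is_derive_line (g : 'rV[R]_n -> R^o) (p v : 'rV[R]_n) (a : R) :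
  differentiable g (p + a *: v) ->
  is_derive a 1 (fun t : R => g (p + t *: v) : R^o) ('d g (p + a *: v) v).
Proof.
move=> dg.
have dl : is_diff a (cst p + ( *:%R ^~ v) : R -> 'rV[R]_n) (0 + ( *:%R ^~ v)).
  exact: is_diffD.
have dc : differentiable (g \o (fun t : R => p + t *: v)) a.
  exact: differentiable_comp.
have := diff_is_derive (1 : R) dc.
by rewrite diff_comp//= diff_val fctE add0r scale1r.
Qed.

Lemma diff_translation (f : 'rV[R]_n -> R^o) (y c : 'rV[R]_n) :
  differentiable f (y + c) ->
  differentiable (fun z => f (z + c)) y /\
  'd (fun z => f (z + c)) y = 'd f (y + c) :> ('rV[R]_n -> R).
Proof.
move=> fyc.
have [dsh shE] : is_diff y (id + cst c : 'rV[R]_n -> 'rV[R]_n) (id + 0).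
  exact: is_diffD.
split; first exact: (differentiable_comp dsh fyc).
apply: (etrans (diff_comp dsh fyc)); apply/funext => v /=.
congr ('d f _ _); apply: (etrans (congr1 (@^~ v) shE)).
exact: addr0.
Qed.

Lemma MVT_line (g : 'rV[R]_n -> R^o) (p v : 'rV[R]_n) (s : R) : 0 < s ->
  (forall t, 0 <= t <= s -> differentiable g (p + t *: v)) ->
  exists2 c, 0 <= c <= s & g (p + s *: v) - g p = 'd g (p + c *: v) v * s.
Proof.
move=> s0 gd.
have gder t : 0 <= t <= s ->
    is_derive t 1 (fun t : R => g (p + t *: v) : R^o) ('d g (p + t *: v) v).
  by move=> /gd; exact: is_derive_line.
have [t|t|c] := @MVT_segment R (fun t => g (p + t *: v))
  (fun t => 'd g (p + t *: v) v) 0 s (ltW s0).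
- by rewrite in_itv/= => /andP[/ltW t0 /ltW ts]; apply: gder; rewrite t0.
- apply: derivable_within_continuous => {}t; rewrite in_itv/= => ts.
  by have [] := gder t ts.
- rewrite in_itv/= => cs; rewrite scale0r addr0 subr0 => E.
  by exists c.
Qed.

(** The mean value theorem is applied along [v] to the increment of [f] by [s *: w], then along [w]
    to the derivative of [f] in direction [v]. *)
Lemma second_difference U (f : 'rV[R]_n -> R^o) x v w s :
  (forall a b, 0 <= a <= s -> 0 <= b <= s -> U (x + a *: v + b *: w)) ->
  0 < s -> Ck_on 2 U f ->
  exists a b, [/\ 0 <= a <= s, 0 <= b <= s &
    f (x + s *: v + s *: w) - f (x + s *: v) - (f (x + s *: w) - f x) =
    'd (fun y => 'd f y v : R^o) (x + a *: v + b *: w) w * s * s].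
Proof.
move=> xU s0 [fd fC]; have [fvd _] := fC v.
have s0s : 0 <= s <= s by rewrite lexx ltW.
have s00 : 0 <= (0 : R) <= s by rewrite lexx ltW.
pose g (y : 'rV[R]_n) : R^o := f (y + s *: w) - f y.
have gD y : U y -> U (y + s *: w) ->
    differentiable g y /\ 'd g y v = 'd f (y + s *: w) v - 'd f y v.
  move=> /fd fy /fd fyw.
  have [dc E] := diff_translation fyw.
  split; first exact: (differentiableB dc fy).
  apply: (etrans (congr1 (@^~ v) (diffB dc fy))).
  exact: (congr1 (fun h => h v - 'd f y v) E).
have gU a : 0 <= a <= s -> U (x + a *: v) /\ U (x + a *: v + s *: w).
  by move=> sa; split; [have := xU _ _ sa s00; rewrite scale0r addr0|exact: xU].
have [a sa Ea] : exists2 a, 0 <= a <= s &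
    g (x + s *: v) - g x = 'd g (x + a *: v) v * s.
  by apply: MVT_line => // a sa; have [/gD/[apply]-[]] := gU a sa.
have [b sb Eb] : exists2 b, 0 <= b <= s &
    'd f (x + a *: v + s *: w) v - 'd f (x + a *: v) v =
    'd (fun y => 'd f y v : R^o) (x + a *: v + b *: w) w * s.
  by apply: (@MVT_line (fun y => 'd f y v)) => // b sb; apply: fvd; exact: xU.
exists a, b; split=> //; rewrite -Eb.
have [/gD/[apply]-[_ <-]] := gU a sa.
by rewrite -Ea.
Qed.

(* By the mean value theorem used twice, the symmetric second difference of f
   along v and w is a value of each of the two mixed derivatives near x. *)
Lemma diff_symmetric U (f : 'rV[R]_n -> R^o) x v w : open U -> U x ->
  Ck_on 2 U f ->
  'd (fun y => 'd f y v : R^o) x w = 'd (fun y => 'd f y w : R^o) x v.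
Proof.
move=> oU Ux fC2; set A := LHS; set B := RHS; apply: contrapT => /eqP neq.
set e := `|A - B| / 2.
have e0 : 0 < e by rewrite divr_gt0// normr_gt0 subr_eq0.
have [fd fC] := fC2.
have cvw u z :
    {for x, continuous (fun y => 'd (fun y => 'd f y u : R^o) y z : R^o)}.
  by have [_ /(_ z) /(_ x Ux)] := fC u.
have : \forall y \near x, [/\ U y,
    `|A - 'd (fun y => 'd f y v : R^o) y w| < e &
    `|B - 'd (fun y => 'd f y w : R^o) y v| < e].
  near=> y; split; near: y.
  - exact: open_nbhs_nbhs.
  - by move/cvgrPdist_lt: (cvw v w); apply.
  - by move/cvgrPdist_lt: (cvw w v); apply.
move=> /nbhs_ballP[r /= r0 rP].
(* The summand 1 keeps [c] positive even when v = w = 0, and makes s (|v| + |w|) strictly smaller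
   than r, so that the whole parallelogram lies in the ball. *)
set c := `|v| + `|w| + 1.
have c0 : 0 < c by rewrite ltr_wpDl// addr_ge0.
set s := r / c.
have s0 : 0 < s by rewrite divr_gt0.
have H a b : 0 <= a <= s -> 0 <= b <= s -> ball x r (x + a *: v + b *: w).
  move=> /andP[a0 sa] /andP[b0 sb].
  rewrite -ball_normE/= -addrA opprD addNKr normrN.
  rewrite (le_lt_trans (ler_normD _ _))// !normrZ !ger0_norm//.
  have -> : r = s * c by rewrite /s divfK// gt_eqF.
  rewrite (@le_lt_trans _ _ (s * (`|v| + `|w|)))//.
    by rewrite mulrDr lerD// ler_wpM2r.
  by rewrite ltr_pM2l// /c ltrDl.
have [a [b [sa sb E1]]] := second_difference
  (fun a b sa sb => let: And3 h _ _ := rP _ (H a b sa sb) in h) s0 fC2.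
have H' a1 b1 : 0 <= a1 <= s -> 0 <= b1 <= s ->
    ball x r (x + a1 *: w + b1 *: v).
  by move=> sa' sb'; rewrite addrAC; exact: H.
have [a' [b' [sa' sb' E2]]] := second_difference
  (fun a b sa sb => let: And3 h _ _ := rP _ (H' a b sa sb) in h) s0 fC2.
have /rP[_ Ha _] := H _ _ sa sb.
have /rP[_ _ Hb] := H' _ _ sa' sb'.
(* Exchanging [v] and [w] does not change the second difference, so cancelling [s] twice equates the
   two mixed derivatives at their intermediate points. *)
have E : 'd (fun y => 'd f y v : R^o) (x + a *: v + b *: w) w =
         'd (fun y => 'd f y w : R^o) (x + a' *: w + b' *: v) v.
  apply: (@mulIf _ s); first by rewrite gt_eqF.
  apply: (@mulIf _ s); first by rewrite gt_eqF.
  rewrite -E1 -E2 (addrAC x) !opprB -!addrA; congr (_ + _).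
  by rewrite addrCA [RHS]addrCA; congr (_ + _); exact: addrC.
rewrite -E in Hb.
(* The common value lies within [e] of both [A] and [B], whose distance is exactly 2e. *)
have : `|A - B| < e + e.
  rewrite -(subrK ('d (fun y => 'd f y v : R^o) (x + a *: v + b *: w) w) A).
  rewrite -addrA (le_lt_trans (ler_normD _ _))// ltrD//.
  by rewrite distrC.
by rewrite -splitr ltxx.
Unshelve. all: by end_near. Qed.

Lemma diff_symmetric_rV m U (f : 'rV[R]_n -> 'rV[R]_m) x v w : open U -> U x ->
  Ck_on 2 U f -> 'd (fun y => 'd f y v) x w = 'd (fun y => 'd f y w) x v.
Proof.
move=> oU Ux fC; apply/rowP => a.
have [fd fC1] := fC.
have E u z : 'd (fun y => 'd f y u) x z 0 a =
    'd (fun y => 'd (fun y => f y 0 a : R^o) y u : R^o) x z.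
  have [fud _] := fC1 u.
  have [dfua <-] := diff_mxcoord 0 a (fud x Ux).
  have N : {near x, (fun y => 'd f y u 0 a : R^o) =1
                    (fun y => 'd (fun y => f y 0 a : R^o) y u : R^o)}.
    apply: (open_near oU _ Ux) => y Uy.
    by have [_ ->] := diff_mxcoord 0 a (fd y Uy).
  exact: (esym (congr1 (@^~ z) (near_eq_is_diff N dfua).2)).
rewrite !E; exact (diff_symmetric v w oU Ux (Ck_on_mxcoord 0 a oU fC)).
Qed.

End SecondDerivative.

(** * Determinants *)

Section Determinants.
Context {R : realType}.

(** If u A A^T = 0, then uA has squared norm 0; over the reals this forces uA = 0, hence u = 0
    because the rows of [A] are independent. *)
Lemma gram_det_neq0 p q (A : 'M[R]_(p, q)) :
  row_free A -> \det (A *m A^T) != 0.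
Proof.
move=> freeA; rewrite -unitfE -[_ \in _]/(_ \in unitmx) -row_free_unit.
apply: inj_row_free => u uAA; apply/eqP; rewrite -(mulmx_free_eq0 u freeA).
have /eqP : ((u *m A) *m (u *m A)^T) 0 0 = 0.
  by rewrite trmx_mul mulmxA -(mulmxA u) uAA mul0mx mxE.
rewrite mxE psumr_eq0 => [|j _]; last by rewrite [X in _ * X]mxE -expr2 sqr_ge0.
move=> /allP uA0.
apply/eqP/rowP => j; apply/eqP; have := uA0 j (mem_index_enum _).
by rewrite /= [X in _ * X]mxE mulf_eq0 orbb [X in _ -> _ == X]mxE; apply.
Qed.

Lemma det_set_row p l (u : 'rV[R]_p) (V : 'M[R]_p) :
  \det (set_row l u V) = \sum_j u 0 j * cofactor V l j.
Proof.
rewrite (expand_det_row _ l); apply: eq_bigr => j _.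
rewrite !mxE eqxx; congr (_ * (_ * \det _)).
by apply/matrixP => a b; rewrite !mxE eq_sym (negPf (neq_lift _ _)) mxE.
Qed.

(** Expanding in cofactors, the sum is the trace of V A adj(V), and cyclicity of the trace brings
    adj(V) V = det V together. With [A] the Jacobian of a field, this produces its divergence. *)
Lemma sum_det_set_row p (V A : 'M[R]_p) :
  \sum_l \det (set_row l (row l V *m A) V) = \det V * \tr A.
Proof.
transitivity (\tr (V *m A *m \adj V)).
  apply: eq_bigr => l _; rewrite det_set_row mxE; apply: eq_bigr => j _.
  by rewrite -row_mul !mxE.
by rewrite mxtrace_mulC mulmxA mul_adj_mx mul_scalar_mx linearZ.
Qed.

(* The scalar h such that h * det V is the form determined by Y and J, obtained
   by evaluating both on the frame col_mx Y J^T; see [fiber_densityP]. *)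
Definition fiber_density p q (Y : 'M[R]_(p, p + q))
    (J : 'M[R]_(p + q, q)) : R :=
  \det (J^T *m J) / \det (col_mx Y J^T).

Section FiberDensity.
Variables (p q : nat) (Y : 'M[R]_(p, p + q)) (J : 'M[R]_(p + q, q)).
Hypotheses (YJ : Y *m J = 0) (freeY : row_free Y) (freeJ : row_free J^T).

(** The product of [col_mx Y Z] with the transpose of [col_mx Y J^T] is block lower triangular,
    since Y J = 0; its diagonal blocks are Y Y^T and Z J. *)
Let mul_frame (Z : 'M[R]_(q, p + q)) :
  \det (col_mx Y Z) * \det (col_mx Y J^T) = \det (Y *m Y^T) * \det (Z *m J).
Proof.
rewrite -[in X in _ * X](trmxK (col_mx Y J^T)) (det_tr (_^T)) -det_mulmx.
by rewrite tr_col_mx trmxK mul_col_row YJ det_lblock.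
Qed.

Let detJJ : \det (J^T *m J) != 0.
Proof. by have := gram_det_neq0 freeJ; rewrite trmxK. Qed.

Lemma det_frame_neq0 : \det (col_mx Y J^T) != 0.
Proof.
(* With Z = J^T, [mul_frame] makes this square a product of two nonzero Gram determinants. *)
have : \det (col_mx Y J^T) * \det (col_mx Y J^T) != 0.
  by rewrite mul_frame mulf_neq0// gram_det_neq0.
by rewrite mulf_eq0 orbb.
Qed.

Lemma fiber_density_neq0 : fiber_density Y J != 0.
Proof. by rewrite mulf_neq0// invr_eq0 det_frame_neq0. Qed.

(** After multiplication by the nonzero det(Y Y^T), [mul_frame], used for [Z] and for J^T, turns
    both sides into the determinant of [col_mx Y Z] times that of the frame. *)
Lemma fiber_densityP (Z : 'M[R]_(q, p + q)) :
  fiber_density Y J * \det (col_mx Y Z) = \det (Z *m J).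
Proof.
have N0 := det_frame_neq0; apply: (mulfI (gram_det_neq0 freeY)).
rewrite -mul_frame /fiber_density.
rewrite mulrA [_ * (_ / _)]mulrA -mul_frame.
by rewrite mulfK// mulrC.
Qed.

End FiberDensity.

End Determinants.

(** * Derivative of a determinant along a vector *)

Section DetDerivative.
Context {R : realType} {V : normedModType R}.

Lemma is_derive_bigsum (I : Type) (r : seq I) (P : pred I) (f : I -> V -> R^o)
    (df : I -> R) x v : (forall i, is_derive x v (f i) (df i)) ->
  is_derive x v (fun y => \sum_(i <- r | P i) f i y : R^o)
    (\sum_(i <- r | P i) df i).
Proof.
move=> fd; elim: r => [|i r IH].
  rewrite big_nil (_ : (fun y => _) = cst 0); first exact: is_derive_cst.
  by apply/funext => y; rewrite big_nil.
rewrite big_cons; case Pi : (P i).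
  rewrite (_ : (fun y => _) = f i + (fun y => \sum_(j <- r | P j) f j y)).
    exact: is_deriveD.
  by apply/funext => y; rewrite big_cons Pi.
rewrite (_ : (fun y => _) = (fun y => \sum_(j <- r | P j) f j y))//.
by apply/funext => y; rewrite big_cons Pi.
Qed.

Lemma is_derive_bigprod p (f : 'I_p -> V -> R^o) (df : 'I_p -> R) x v :
  (forall i, is_derive x v (f i) (df i)) ->
  is_derive x v (fun y => \prod_i f i y : R^o)
    (\sum_i \prod_j (if j == i then df j else f j x)).
Proof.
elim: p f df => [|p IH] f df fd.
  rewrite big_ord0 (_ : (fun y => _) = cst 1); first exact: is_derive_cst.
  by apply/funext => y; rewrite big_ord0.
rewrite (_ : (fun y => _) =
    f ord0 * (fun y => \prod_(i < p) f (lift ord0 i) y)); last first.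
  by apply/funext => y; rewrite big_ord_recl.
have H := is_deriveM (fd ord0) (IH _ _ (fun i => fd (lift ord0 i))).
apply: (is_derive_eq H); rewrite big_ord_recl addrC; congr (_ + _).
  rewrite big_ord_recl eqxx mulrC; congr (_ * _).
rewrite [LHS]mulr_sumr; apply: eq_bigr => i _.
by rewrite big_ord_recl.
Qed.

(** The Leibniz rule is applied to each term of the permutation expansion, and the result is
    regrouped by the row that is differentiated. *)
Lemma is_derive_det p (A : V -> 'M[R]_p) (dA : 'M[R]_p) x v :
  (forall i j, is_derive x v (fun y => A y i j : R^o) (dA i j)) ->
  is_derive x v (fun y => \det (A y) : R^o)
    (\sum_l \det (set_row l (row l dA) (A x))).
Proof.
move=> Ad.
apply: is_derive_eq.
  apply: is_derive_bigsum => s; apply: is_deriveZ.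
  by apply: is_derive_bigprod => i; exact: Ad.
rewrite exchange_big; apply: eq_bigr => s _; rewrite scaler_sumr.
apply: eq_bigr => l _; congr (_ * _); apply: eq_bigr => j _.
by rewrite mxE; case: eqP => [->|_]; rewrite mxE.
Qed.

End DetDerivative.

(** * The local density *)

Section LocalDensity.
Context {R : realType}.

Lemma map_rowsE n k (f : {linear 'rV[R]_n -> 'rV[R]_n}) (V : 'M[R]_(k, n)) :
  map_rows f V = V *m lin1_mx f.
Proof. by apply/row_matrixP => l; rewrite rowK row_mul mul_rV_lin1. Qed.

Lemma jacobian_rowE n m (G : 'rV[R]_n -> 'rV[R]_m) x v :
  'd G x v = v *m jacobian G x.
Proof. by rewrite mul_rV_lin1. Qed.

Lemma jacobian_entryE n m (G : 'rV[R]_n -> 'rV[R]_m) x k a :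
  jacobian G x k a = 'd G x (delta_mx 0 k) 0 a.
Proof. by rewrite mxE. Qed.

Lemma Ck_on_jacobian k n m (U : set 'rV[R]_n) (G : 'rV[R]_n -> 'rV[R]_m) j a :
  open U -> Ck_on k.+1 U G -> Ck_on k U (fun y => jacobian G y j a : R^o).
Proof.
move=> oU [_ GC]; have H := Ck_on_mxcoord 0 a oU (GC (delta_mx 0 j)).
by apply: (Ck_on_ext oU _ H) => y _; rewrite jacobian_entryE.
Qed.

(* Differentiate dG (X) = 0 and use the symmetry of the second derivative. *)
Lemma is_derive_jacobian n m (U : set 'rV[R]_n) (X : 'rV[R]_n -> 'rV[R]_n)
    (G : 'rV[R]_n -> 'rV[R]_m) x k a : open U -> U x ->
  Ck_on 1 U X -> Ck_on 2 U G -> (forall y, U y -> 'd G y (X y) = 0) ->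
  is_derive x (X x) (fun y => jacobian G y k a : R^o)
    ((- (jacobian X x *m jacobian G x)) k a).
Proof.
move=> oU Ux [Xd _] GC GX0; have [Gd GC1] := GC.
have JE j : (fun y => jacobian G y j a : R^o) =
    (fun y => 'd G y (delta_mx 0 j) 0 a : R^o).
  by apply/funext => y; rewrite jacobian_entryE.
have Jd j v : is_derive x v (fun y => jacobian G y j a : R^o)
    ('d (fun y => 'd G y (delta_mx 0 j)) x v 0 a).
  rewrite JE; have [Gjd _] := GC1 (delta_mx 0 j).
  have [d dE] := diff_mxcoord 0 a (Gjd x Ux).
  exact: (is_derive_eq (diff_is_derive v d) (dE v)).
have Xjd j v : is_derive x v (fun y => X y 0 j : R^o) ('d X x v 0 j).
  have [d dE] := diff_mxcoord 0 j (Xd x Ux).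
  exact: (is_derive_eq (diff_is_derive v d) (dE v)).
(* Differentiating the component [a] of dG (X) in the direction [e] gives two sums: one with second
   derivatives of [G], the other equal to the entry (k, a) of [jacobian X x *m jacobian G x]. *)
pose e := delta_mx 0 k : 'rV[R]_n.
have : is_derive x e (fun y => \sum_j X y 0 j * jacobian G y j a : R^o)
    (\sum_j (X x 0 j * 'd (fun y => 'd G y (delta_mx 0 j)) x e 0 a +
             jacobian G x j a * 'd X x e 0 j)).
  by apply: is_derive_bigsum => j; exact: is_deriveM.
have S0 y : U y -> \sum_j X y 0 j * jacobian G y j a = 0.
  by move=> /GX0/rowP/(_ a); rewrite jacobian_rowE !mxE.
have S0n : \forall y \near x, \sum_j X y 0 j * jacobian G y j a = cst 0 y.
  exact: (open_near oU S0 Ux).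
move=> /(near_eq_is_derive S0n)[_].
rewrite derive_cst big_split /= => E.
apply: (is_derive_eq (Jd k (X x))); apply/eqP.
rewrite [X in _ == X]mxE -addr_eq0 [in X in _ + X]mxE; apply/eqP.
rewrite [RHS]E; congr (_ + _); last first.
  by apply: eq_bigr => j _; rewrite mulrC (jacobian_entryE X).
(* The derivative along [X x] is expanded in coordinate directions; symmetry then matches it term by
   term with the second-derivative sum. *)
apply: etrans (congr1 (fun u : 'rV[R]_m => u 0 a)
  (jacobian_rowE (fun y => 'd G y e) x (X x))) _.
rewrite mxE; apply: eq_bigr => j _; rewrite jacobian_entryE; congr (_ * _).
have := diff_symmetric_rV e (delta_mx 0 j) oU Ux GC.
exact: (congr1 (fun u : 'rV[R]_m => u 0 a)).
Qed.

Section Density.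
Variables (p q : nat) (U : set 'rV[R]_(p + q)).
Variables (Y : 'rV[R]_(p + q) -> 'M[R]_(p, p + q)).
Variables (G : 'rV[R]_(p + q) -> 'rV[R]_q).
Hypothesis oU : open U.
Hypothesis YC : forall k l j, Ck_on k U (fun y => Y y l j : R^o).
Hypothesis GC : smooth_on U G.
Hypothesis YJ : forall y, U y -> Y y *m jacobian G y = 0.
Hypothesis freeY : forall y, U y -> row_free (Y y).
Hypothesis freeJ : forall y, U y -> row_free (jacobian G y)^T.

Let J y := jacobian G y.
Let h y := fiber_density (Y y) (J y).

Lemma smooth_fiber_density : smooth_on U (h : _ -> R^o).
Proof.
move=> k; have JC i j : Ck_on k U (fun y => J y i j : R^o).
  exact: Ck_on_jacobian.
apply: Ck_onM => //.
  apply: Ck_on_det => // i j.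
  have : Ck_on k U (fun y => \sum_l J y l i * J y l j : R^o).
    by apply: Ck_on_sum => // l; exact: Ck_onM.
  apply: Ck_on_ext => // y _.
  by rewrite !mxE; under [RHS]eq_bigr do rewrite mxE.
apply: Ck_onV => //.
  by move=> y Uy; apply: det_frame_neq0; [exact: YJ|exact: freeY|exact: freeJ].
apply: Ck_on_det => // i j; case: (split_ordP i) => l ->.
  by apply: Ck_on_ext (YC k l j) => // y _; rewrite col_mxEu.
by apply: Ck_on_ext (JC j l) => // y _; rewrite col_mxEd [RHS]mxE.
Qed.

(** The last hypothesis is [X, Y_l] = 0 at [x] in coordinates. The terms h det that come from
    differentiating the rows of [Y] and the rows of Z J add up to h det(W) div X by
    [sum_det_set_row]. *)
Lemma fiber_density_invariant (X : 'rV[R]_(p + q) -> 'rV[R]_(p + q)) x :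
  U x -> smooth_on U X -> (forall y, U y -> 'd G y (X y) = 0) ->
  (forall l j, is_derive x (X x) (fun y => Y y l j : R^o)
                 ((Y x *m jacobian X x) l j)) ->
  'd (h : _ -> R^o) x (X x) + h x * \tr (jacobian X x) = 0.
Proof.
(* [Z] is frozen at [x]: it does not contribute to the derivative, yet it completes [Y x] to an
   invertible frame. *)
move=> Ux XC GX0 YX; set D := jacobian X x; set Z := (J x)^T.
pose W y := col_mx (Y y) Z.
have W0 : \det (W x) != 0.
  by apply: det_frame_neq0; [exact: YJ|exact: freeY|exact: freeJ].
have hW y : U y -> h y * \det (W y) = \det (Z *m J y).
  by move=> Uy; apply: fiber_densityP; [exact: YJ|exact: freeY|exact: freeJ].
pose dW : 'M[R]_(p + q) := col_mx (Y x *m D) 0.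
have Wd i j : is_derive x (X x) (fun y => W y i j : R^o) (dW i j).
  case: (split_ordP i) => l ->; rewrite /dW ?col_mxEu ?col_mxEd.
    rewrite (_ : (fun y => _) = (fun y => Y y l j))//.
    by apply/funext => y; rewrite col_mxEu.
  rewrite (_ : (fun y => _) = cst (Z l j)); last first.
    by apply/funext => y; rewrite col_mxEd.
  by rewrite [X in is_derive _ _ _ X]mxE; exact: is_derive_cst.
have ZJd i j : is_derive x (X x) (fun y => (Z *m J y) i j : R^o)
    ((Z *m - (D *m J x)) i j).
  rewrite (_ : (fun y => _) = (fun y => \sum_k Z i k * J y k j)); last first.
    by apply/funext => y; rewrite mxE.
  rewrite mxE; apply: is_derive_bigsum => k.
  have := is_derive_jacobian k j oU Ux (XC 1%N) (GC 2) GX0.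
  exact: is_deriveZ.
have hd : is_derive x (X x) (h : _ -> R^o) ('d (h : _ -> R^o) x (X x)).
  by apply: diff_is_derive; have [/(_ x Ux)] := smooth_fiber_density 1%N.
have hWn : \forall y \near x, \det (Z *m J y) = h y * \det (W y).
  by apply: (open_near oU _ Ux) => y /hW.
have [_ EL] := is_deriveM hd (is_derive_det Wd).
have [_ ER] := near_eq_is_derive hWn (is_derive_det ZJd).
have {EL ER} E := etrans (esym EL) ER.
have top l : \det (set_row (lshift q l) (row (lshift q l) dW) (W x)) =
    \det (set_row (lshift q l) (row (lshift q l) (W x) *m D) (W x)).
  by congr (\det (set_row _ _ _)); rewrite -row_mul mul_col_mx !rowKu.
have bottom l : \det (set_row (rshift p l) (row (rshift p l) dW) (W x)) = 0.
  by rewrite det_set_row big1// => j _; rewrite rowKd row0 mxE mul0r.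
(* The density equation is used again at [x], now with row [a] of [Z] multiplied by [D]; this
   supplies the bottom-row terms of [sum_det_set_row], with a minus sign. *)
have dZJ a : \det (set_row a (row a (Z *m - (D *m J x))) (Z *m J x)) =
    - (h x * \det (set_row (rshift p a) (row (rshift p a) (W x) *m D) (W x))).
  have -> : set_row (rshift p a) (row (rshift p a) (W x) *m D) (W x) =
      col_mx (Y x) (set_row a (row a Z *m D) Z).
    apply/row_matrixP => i; rewrite rowK; case: (split_ordP i) => l ->.
      by rewrite eq_lrshift rowKu rowKu.
    rewrite eq_rshift rowKd rowKd rowKd rowK.
    by case: eqP.
  rewrite fiber_densityP; [|exact: YJ|exact: freeY|exact: freeJ].
  have -> : set_row a (row a Z *m D) Z *m J x =
      set_row a (row a Z *m D *m J x) (Z *m J x).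
    apply/row_matrixP => i; rewrite row_mul !rowK.
    by case: eqP => // _; rewrite row_mul.
  rewrite !det_set_row -sumrN; apply: eq_bigr => j _.
  by rewrite mulmxN linearN /= mxE mulNr row_mul mulmxA.
have := sum_det_set_row (W x) D.
move: E; rewrite !big_split_ord /= (eq_bigr _ (fun l _ => top l)).
rewrite (eq_bigr _ (fun l _ => bottom l)) big1_eq addr0.
rewrite (eq_bigr _ (fun l _ => dZJ l)) sumrN -mulr_sumr.
(* Here [E] reads h S1 + det(W) X h = - h S2, and [S12] reads S1 + S2 = det(W) tr D. *)
set S1 := \sum_(l < p) _; set S2 := \sum_(l < q) _ => E S12.
apply: (mulfI W0); rewrite mulr0 mulrDr mulrCA -S12 mulrDr.
rewrite addrA [_ * _ + _]addrC [X in X + _]E.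
by rewrite addNr.
Qed.

End Density.

End LocalDensity.

(** * The fiber volume form *)

Section FiberVolumeForm.
Context {R : realType} {p q : nat} (M : manifold R (p + q)).
Notation I := (idx (matlas M)).

Lemma open_cod (i : I) : open (cod i).
Proof. exact: cod_open. Qed.

Lemma transition_differentiable (i j : I) x : overlap i j x ->
  differentiable (transition i j) x.
Proof.
by move=> ox; have [/(_ 1%N)[d _] _] := matlas_smooth i j; exact: d.
Qed.

Lemma transition_cod (i j : I) x : overlap i j x ->
  [/\ cod i x, cod j (transition i j x) &
      pchart j (transition i j x) = pchart i x].
Proof.
move=> [a [ia ja] <-]; split; first by exists a.
  by exists a => //; rewrite /transition /= chartK.
by rewrite /transition /= !chartK.
Qed.

(** Continuity of [pchart i] pulls the open set [dom j] back to a neighbourhood of [x], on which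
    coordinate expressions in the two charts can be compared and differentiated. *)
Lemma overlap_near (i j : I) x :
  overlap i j x -> \forall y \near x, overlap i j y.
Proof.
move=> ox; have [ix _ _] := transition_cod ox.
have jx : dom j (pchart i x) by case: ox => [a [ia ja] <-]; rewrite chartK.
have near_j : \forall y \near x, dom j (pchart i y).
  apply: (pchart_continuous ix); apply: open_nbhs_nbhs; split=> //.
  exact: dom_open.
have near_i : \forall y \near x, cod i y.
  exact: (open_nbhs_nbhs (conj (@open_cod i) ix)).
apply: filterS2 near_i near_j => y [a ia <-]; rewrite chartK// => ja.
by exists a.
Qed.

Variables (X : vector_field M) (F : M -> 'rV[R]_q) (Y : 'I_p -> vector_field M).
Hypotheses (F_smooth : smooth_map F) (F_submersion : submersion F).
Hypothesis F_X : forall a, first_integral X (component F a).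
Hypothesis Y_free : independent_fields Y.
Hypothesis Y_X : forall l, commuting (Y l) X.
Hypothesis F_Y : forall l a, first_integral (Y l) (component F a).

Let G (i : I) := F \o pchart i.
Let Ym (i : I) x := \matrix_(l < p) Y l i x.

Lemma first_integral_diff (Z : vector_field M) i x :
  (forall a, first_integral Z (component F a)) -> cod i x ->
  'd (G i) x (Z i x) = 0.
Proof.
move=> FZ ix; apply/rowP => a; have [Gd _] := F_smooth i 1%N.
have [_ dE] := diff_mxcoord 0 a (Gd x ix).
rewrite [RHS]mxE; exact: (etrans (esym (dE _)) (FZ a i x ix)).
Qed.

Let YJ i x : cod i x -> Ym i x *m jacobian (G i) x = 0.
Proof.
move=> ix; apply/row_matrixP => l; rewrite row_mul rowK -jacobian_rowE row0.
exact: first_integral_diff.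
Qed.

Let freeJ i x : cod i x -> row_free (jacobian (G i) x)^T.
Proof.
move=> ix; have surj := F_submersion ix.
have pre a : exists v : 'rV[R]_(p + q),
      v *m jacobian (G i) x = delta_mx 0 a.
  have : range ('d (G i) x) (delta_mx 0 a) by rewrite surj.
  by move=> [v _ vE]; exists v; rewrite -jacobian_rowE.
(* Preimages of the basis vectors under dG, stacked as rows, form a left inverse of the Jacobian. *)
apply/row_freeP; exists (\matrix_a sval (cid (pre a)))^T.
apply: trmx_inj; rewrite trmx_mul !trmxK trmx1.
apply/row_matrixP => a; rewrite row_mul rowK row1.
exact: (svalP (cid (pre a))).
Qed.

Let Y_smooth i k l j : Ck_on k (cod i) (fun y => Ym i y l j : R^o).
Proof.
have H := Ck_on_mxcoord 0 j (@open_cod i) (@vf_smooth _ _ _ (Y l) i k).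
by apply: (Ck_on_ext (@open_cod i) _ H) => y _; rewrite mxE.
Qed.

Let h i x := fiber_density (Ym i x) (jacobian (G i) x).

Let h_smooth i : smooth_on (cod i) (h i : _ -> R^o).
Proof.
apply: smooth_fiber_density.
- exact: open_cod.
- exact: Y_smooth.
- exact: F_smooth.
- exact: YJ.
- exact: Y_free.
- exact: freeJ.
Qed.

(** The chain rule for [G] and the transformation law of [Y] carry the density equation in chart [j]
    to the one in chart [i]. Comparing them on a single invertible frame suffices, and the Jacobian
    determinant enters with its sign. *)
Let h_transition i j x : overlap i j x ->
  h j (transition i j x) * \det (jacobian (transition i j) x) = h i x.
Proof.
move=> ox; have [ix jx xE] := transition_cod ox.
set D := jacobian _ x; set x' := transition i j x.
have dT := transition_differentiable ox.
have [Gd _] := F_smooth j 1%N.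
have JE : jacobian (G i) x = D *m jacobian (G j) x'.
  have N : {near x, G j \o transition i j =1 G i}.
    move: (overlap_near ox); apply: filterS => y /transition_cod[_ _ yE].
    by rewrite /G /= yE.
  have dG := differentiable_comp dT (Gd x' jx).
  apply/row_matrixP => k; rewrite rowE -jacobian_rowE row_mul rowE.
  rewrite -(jacobian_rowE (transition i j)) -jacobian_rowE.
  apply: (etrans (congr1 (@^~ _) (near_eq_is_diff N dG).2)).
  exact: (congr1 (@^~ _) (diff_comp dT (Gd x' jx))).
have YE : Ym j x' = Ym i x *m D.
  apply/row_matrixP => l; rewrite row_mul !rowK vf_compat//.
  exact: jacobian_rowE.
set Z := (jacobian (G i) x)^T.
have W0 : \det (col_mx (Ym i x) Z) != 0.
  by apply: det_frame_neq0; [exact: YJ|exact: Y_free|exact: freeJ].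
have WD : \det (col_mx (Ym j x') (Z *m D)) =
    \det D * \det (col_mx (Ym i x) Z).
  by rewrite YE -mul_col_mx det_mulmx mulrC.
have hW k y (V : 'M[R]_(q, p + q)) : cod k y ->
    h k y * \det (col_mx (Ym k y) V) = \det (V *m jacobian (G k) y).
  by move=> ky; apply: fiber_densityP; [exact: YJ|exact: Y_free|exact: freeJ].
apply: (mulIf W0); rewrite -mulrA -WD.
apply: (etrans (hW j x' (Z *m D) jx)); apply: etrans (esym (hW i x Z ix)).
apply: etrans (congr1 (fun A => \det (Z *m A)) (esym JE)).
exact: (congr1 (fun A => \det A) (esym (mulmxA Z D _))).
Qed.

Let mu_multilinear i x : cod i x ->
  multilinear (fun V : 'M[R]_(p + q) => h i x * \det V).
Proof.
move=> _ l V a u v; rewrite !det_set_row mulrCA -mulrDr; congr (_ * _).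
rewrite mulr_sumr -big_split; apply: eq_bigr => j _ /=.
by rewrite !mxE mulrDl -mulrA.
Qed.

Let mu_alternating i x : cod i x ->
  Defs.alternating (fun V : 'M[R]_(p + q) => h i x * \det V).
Proof.
move=> _ V l l' ll' /rowP E.
rewrite (determinant_alternate ll') ?mulr0// => j.
by have := E j; rewrite !mxE.
Qed.

Let mu_smooth i (V : 'M[R]_(p + q)) :
  smooth_on (cod i) (fun x => h i x * \det V : R^o).
Proof.
move=> k; apply: Ck_onM; first exact: open_cod.
  exact: h_smooth.
exact: Ck_on_cst.
Qed.

Let mu_compat i j x (V : 'M[R]_(p + q)) : overlap i j x ->
  h j (transition i j x) * \det (map_rows ('d (transition i j) x) V) =
  h i x * \det V.
Proof.
move=> ox; rewrite map_rowsE det_mulmx.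
apply: (etrans (mulrCA _ _ _)).
exact: (etrans (congr1 ( *%R (\det V)) (h_transition ox)) (mulrC _ _)).
Qed.

Definition fiber_volume_form : diff_form M (p + q) :=
  Form mu_multilinear mu_alternating mu_smooth mu_compat.

Lemma fiber_volume_form_volume : volume_form fiber_volume_form.
Proof.
move=> i x ix; exists 1%:M; rewrite /= det1 mulr1.
by apply: fiber_density_neq0; [exact: YJ|exact: Y_free|exact: freeJ].
Qed.

(** By [sum_det_set_row] the Lie derivative of h det at [V] is det V (X h + h div X), which reduces
    the claim to [fiber_density_invariant]. *)
Lemma fiber_volume_form_invariant : invariant_form X fiber_volume_form.
Proof.
move=> i x ix V; rewrite /lie_form /=.
have [hd _] := h_smooth i 1%N.
have hE : 'd (fun y => h i y * \det V : R^o) x (X i x) =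
    \det V * 'd (h i : _ -> R^o) x (X i x).
  have -> : (fun y => h i y * \det V : R^o) = \det V *: (h i : _ -> R^o).
    by apply/funext => y; rewrite mulrC.
  exact: (congr1 (@^~ (X i x)) (diffZ (\det V) (hd x ix))).
rewrite hE -mulr_sumr.
under eq_bigr do rewrite jacobian_rowE.
rewrite sum_det_set_row mulrCA -mulrDr.
have -> : 'd (h i : _ -> R^o) x (X i x) + h i x * \tr (jacobian (X i) x) = 0.
  apply: (fiber_density_invariant (@open_cod i)).
  - exact: Y_smooth.
  - exact: F_smooth.
  - exact: YJ.
  - exact: Y_free.
  - exact: freeJ.
  - exact: ix.
  - exact: vf_smooth.
  - by move=> y iy; exact: first_integral_diff.
  move=> l j; have [Yd _] := @vf_smooth _ _ _ (Y l) i 1%N.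
  have [d dE] := diff_mxcoord 0 j (Yd x ix).
  have := is_derive_eq (diff_is_derive (X i x) d) (dE (X i x)).
  have -> : (fun y => Ym i y l j : R^o) = (fun y => Y l i y 0 j : R^o).
    by apply/funext => y; rewrite mxE.
  (* Vanishing of the bracket says that dX (Y_l) = dY_l (X). *)
  have -> : (Ym i x *m jacobian (X i) x) l j = 'd (Y l i) x (X i x) 0 j.
    have /eqP := Y_X l ix; rewrite subr_eq0 => /eqP <-.
    rewrite jacobian_rowE.
    by rewrite !mxE; apply: eq_bigr => k _; rewrite mxE.
  by [].
by rewrite mulr0.
Qed.

End FiberVolumeForm.

(** The equation k = q allows the dimension in the type of [F] to be substituted, so that a map to
    R^(n - 2) can be used once n = 2 + q. *)
Lemma fiber_volume_form_exists (R : realType) (p q k : nat)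
    (M : manifold R (p + q)) (X : vector_field M) (F : M -> 'rV[R]_k)
    (Y : 'I_p -> vector_field M) : k = q ->
  fibration_by_integrals X F -> independent_fields Y ->
  (forall l, commuting (Y l) X) ->
  (forall l a, first_integral (Y l) (component F a)) ->
  exists mu : diff_form M (p + q), volume_form mu /\ invariant_form X mu.
Proof.
move=> kq; subst k => -[Fs _ Fsub _ FX] Yf YX FY.
exists (fiber_volume_form Fs Fsub Yf FY); split.
  exact: fiber_volume_form_volume.
exact: fiber_volume_form_invariant.
Qed.

Theorem theorem3 (R : realType) (n : nat) (hn : (2 <= n)%N)
  (M : manifold R n) (M_connected : connected [set: M]%classic)
  (M_orientable : orientable M)
  (X : vector_field M) (X_never_vanishing : never_vanishing X)
  (X_B_integrable : B_integrable X) :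
  exists mu : diff_form M n, EJ_integrable mu X.
Proof.
(* The sum form of the dimension lets the two fields and the q differentials be stacked as blocks of
   a square matrix; n >= 2 keeps the subtraction exact. *)
have [q nE] : exists q, n = (2 + q)%N by exists (n - 2)%N; rewrite subnKC.
subst n; case: X_B_integrable => F [Y [fibF Yf YX _ FY]].
have [mu [mu_vol mu_inv]] :=
  fiber_volume_form_exists (addKn 2 q) fibF Yf YX FY.
by exists mu; split=> //; exists F.
Qed.
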